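(* There are infinitely many positive integers that cannot be expressed as the sum of two squares and at most two powers of $2$.
   Context: ''Squares'' means squares of integers (so $0$ is allowed), and ''powers of $2$'' means numbers $2^a$ with $a$ a non-negative integer. An integer $n$ is a sum of two squares and at most two powers of $2$ if there exist integers $x,y$ such that $n = x^2+y^2$, or $n = x^2+y^2+2^a$ for some integer $a\ge 0$, or $n = x^2+y^2+2^a+2^b$ for some integers $a,b\ge 0$ (with $a=b$ allowed). *)

(* Defs.v *)
From mathcomp Require Import all_boot all_order all_algebra.
From mathcomp Require Import classical_sets cardinality.

Set Implicit Arguments.
Unset Strict Implicit.
Unset Printing Implicit Defensive.

Import Order.TTheory GRing.Theory Num.Theory.
Local Open Scope ring_scope.

Definition two_squares_and_at_most_two_powers_of_2 (n : int) : Prop :=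
  [\/ exists x y : int, n = x ^+ 2 + y ^+ 2,
      exists (x y : int) (a : nat), n = x ^+ 2 + y ^+ 2 + 2 ^+ a
    | exists (x y : int) (a b : nat),
        n = x ^+ 2 + y ^+ 2 + 2 ^+ a + 2 ^+ b].

(* Main.v *)
Require Import Defs.
From Stdlib Require Import NArith.
From mathcomp Require Import all_boot all_order all_algebra.
From mathcomp Require Import classical_sets cardinality.
From mathcomp Require Import zify.

Import Order.TTheory GRing.Theory Num.Theory.
Local Open Scope classical_set_scope.
Local Open Scope nat_scope.

(** Call a natural number representable when it is a sum of two squares and at
    most two powers of 2.  Doubling preserves non-representability for
    multiples of 18 ([not_representable_double]), so one non-representable
    multiple of 18 yields the infinite family of its products with powers
    of 2.

    Doubling.  Suppose 2 n = s + t with s a sum of two squares, t a sum of at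
    most two powers of 2, and 18 | n.  If t is even, it is twice such a sum
    (this covers 1 + 1 = 2 * 1), s is even, and half an even sum of two squares
    is again one; hence n is representable.  If t is odd, then either t = 3, or
    t = 1 mod 4.  In the first case s = 2 n - 3 is divisible by 3 but not by 9,
    since 9 | n; in the second s = 3 mod 4, since n is even.  Neither is
    possible for a sum of two squares.

    The seed is 1151121374334 = 18 * 63951187463.  Only 858 numbers t do not
    exceed it, and for each of them the difference is shown not to be a sum of
    two squares by the criterion [not_two_squares_mul]: if q = 3 mod 4 and q, r
    are coprime, then q * r is not a sum of two squares.  Indeed some prime
    p = 3 mod 4 has odd exponent in q, hence in q * r, while such a prime has
    even exponent in every positive sum of two squares.  The criterion asks for
    no primality test, only for gcds, so it can be run on binary numbers. *)

(** * Sums of two squares *)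

Definition two_squares (n : nat) : Prop := exists x y : nat, n = x ^ 2 + y ^ 2.

(** With p = 4 k + 3, Fermat gives z^2 = z^(p + 1) = (z^2)^(2 (k + 1)) mod p.
    The outer exponent is even, so x^2 = - y^2 forces x^2 = y^2, hence
    2 x^2 = 0 mod p. *)
Lemma prime_dvdn_sum_sq (p x y : nat) :
  prime p -> p %% 4 = 3 -> p %| x ^ 2 + y ^ 2 -> p %| x.
Proof.
move=> p_pr p4 dvd_xy.
have fermat z : (z ^ 2) ^ (p %/ 4).+1.*2 = z ^ 2 %[mod p].
  rewrite -expnM; have -> : 2 * (p %/ 4).+1.*2 = p.+1 by lia.
  by rewrite expnS -modnMmr fermat_little // modnMmr.
(* Squaring the congruence x ^ 2 = - y ^ 2, without leaving nat. *)
have sq_eq : (x ^ 2) ^ 2 = (y ^ 2) ^ 2 %[mod p].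
  have e : y ^ 2 * (x ^ 2 + y ^ 2) + (x ^ 2) ^ 2
           = x ^ 2 * (x ^ 2 + y ^ 2) + (y ^ 2) ^ 2 by nia.
  case/dvdnP: dvd_xy => k dvd_xy; move: e; rewrite dvd_xy !mulnA => e.
  by rewrite -(modnMDl (y ^ 2 * k)) e modnMDl.
have xy_eq : x ^ 2 = y ^ 2 %[mod p].
  rewrite -fermat -[RHS]fermat -mul2n [in LHS]expnM [in RHS]expnM.
  by rewrite -modnXm sq_eq modnXm.
have : p %| 2 * x ^ 2 by rewrite mul2n -addnn /dvdn -modnDmr xy_eq modnDmr.
rewrite Euclid_dvdM // Euclid_dvdX // andbT dvdn_prime2 //.
by case/orP=> // /eqP p2; rewrite p2 in p4.
Qed.

(** Infinite descent: when p divides the sum it divides both x and y, and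
    dividing both by p lowers the exponent by 2. *)
Lemma logn_sum_sq_even (p x y : nat) :
  prime p -> p %% 4 = 3 -> ~~ odd (logn p (x ^ 2 + y ^ 2)).
Proof.
move=> p_pr p4; have [s] := ubnP (x + y); elim: s x y => // s IHs x y lt_xy.
have [->|xy_gt0] := posnP (x ^ 2 + y ^ 2); first by rewrite logn0.
have [dvd_xy|ndvd_xy] := boolP (p %| x ^ 2 + y ^ 2); last first.
  by rewrite lognE (negPf ndvd_xy) !andbF.
have /dvdnP[x' x_eq] := prime_dvdn_sum_sq _ _ _ p_pr p4 dvd_xy.
rewrite addnC in dvd_xy.
have /dvdnP[y' y_eq] := prime_dvdn_sum_sq _ _ _ p_pr p4 dvd_xy.
have p_gt1 := prime_gt1 p_pr.
have e : x ^ 2 + y ^ 2 = p ^ 2 * (x' ^ 2 + y' ^ 2) by subst; nia.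
have xy'_gt0 : 0 < x' ^ 2 + y' ^ 2 by move: xy_gt0; rewrite e muln_gt0 => /andP[].
rewrite e lognM // ?expn_gt0 ?prime_gt0 // pfactorK // oddD /=.
have le_mulp z : z * 2 <= z * p by rewrite leq_mul2l p_gt1 orbT.
have sum_gt0 : 0 < x' + y'.
  by rewrite addn_gt0; move: xy'_gt0; rewrite addn_gt0 !expn_gt0 !orbF.
by apply: IHs; move: (le_mulp x') (le_mulp y'); lia.
Qed.

(** Otherwise every prime power of the odd number q is 1 mod 4: either its
    prime is 1 mod 4, or it is an odd square. *)
Lemma exists_odd_logn (q : nat) :
  q %% 4 = 3 -> exists2 p, prime p /\ p %% 4 = 3 & odd (logn p q).
Proof.
move=> q4; have q_gt0 : 0 < q by lia.
pose bad p := (p %% 4 == 3) && odd (logn p q).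
have [/hasP[p]|/hasPn nbad] := boolP (has bad (primes q)).
  by rewrite mem_primes => /andP[p_pr _] /andP[/eqP p4 ?]; exists p.
suff : q %% 4 = 1 by rewrite q4.
rewrite [q in LHS]prod_prime_decomp // prime_decompE big_map /=.
rewrite big_seq; apply: (big_ind (fun n => n %% 4 = 1)) => //.
  by move=> m n m4 n4; rewrite -modnMm m4 n4.
move=> p p_q; have := nbad p p_q; rewrite /bad.
have p_odd : odd p.
  move: p_q; rewrite mem_primes => /and3P[_ _ /dvdnP[k q_eq]].
  by have : odd q by [lia]; rewrite q_eq oddM => /andP[].
case: eqP => /= [p4 even_p|p_n4 _].
  have {even_p} -> : logn p q = 2 * (logn p q)./2 by lia.
  by rewrite expnM -modnXm -(modnXm 2 4 p) p4 exp1n.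
have p4 : p %% 4 = 1 by lia.
by rewrite -modnXm p4 exp1n.
Qed.

(** Coprimality keeps the exponent in q of a prime 3 mod 4 unchanged in the
    product. *)
Lemma not_two_squares_mul (q r : nat) :
  q %% 4 = 3 -> coprime q r -> ~ two_squares (q * r).
Proof.
move=> q4 cop_qr [x [y e]].
have [p [p_pr p4] odd_p] := exists_odd_logn q q4.
have := logn_sum_sq_even p x y p_pr p4; rewrite -e.
have p_q : p %| q by move: odd_p; rewrite lognE; case: (p %| q); rewrite ?andbF.
have cop_pr := coprime_dvdl p_q cop_qr.
have r_gt0 : 0 < r.
  by case: r cop_qr {e cop_pr} => //; rewrite /coprime gcdn0 => /eqP q1; rewrite q1 in q4.
rewrite lognM //; last by lia.
by rewrite (logn_coprime cop_pr) addn0 odd_p.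
Qed.

(** x^2 + y^2 = 2 (((x + y) / 2)^2 + ((x - y) / 2)^2), where x and y have the
    same parity. *)
Lemma two_squares_half (n : nat) : two_squares (2 * n) -> two_squares n.
Proof.
case=> x [y]; wlog le_yx : x y / y <= x.
  by move=> H e; case: (leqP y x) => [|/ltnW] le; [|rewrite addnC in e]; apply: (H _ _ le e).
move=> e; have odd_eq : odd x = odd y.
  have : odd (x ^ 2 + y ^ 2) = false by rewrite -e oddM.
  by rewrite oddD !oddX /=; case: odd; case: odd.
exists (x + y)./2, (x - y)./2.
have {odd_eq} [d x_eq] : exists d, x = y + 2 * d by exists (x - y)./2; lia.
have -> : (x + y)./2 = y + d by lia.
have -> : (x - y)./2 = d by lia.
by rewrite x_eq in e; nia.
Qed.

(** * Doubling *)

Definition pow2_sum (t : nat) : Prop :=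
  [\/ t = 0, exists a, t = 2 ^ a | exists a b, t = 2 ^ a + 2 ^ b].

Definition representable (n : nat) : Prop :=
  exists s t, [/\ two_squares s, pow2_sum t & n = s + t].

(** The sum 1 + 1 falls under the first case, as twice the single power 1; this
    is why at most two powers are allowed rather than exactly two. *)
Lemma pow2_sum_cases (t : nat) : pow2_sum t ->
  [\/ exists2 t', pow2_sum t' & t = 2 * t', t = 3 | t %% 4 = 1].
Proof.
have pow4 c : 2 ^ c.+2 %% 4 = 0 by rewrite !expnS; lia.
case=> [->|[[|a] ->]|[a [b]]]; first by constructor 1; exists 0 => //; constructor 1.
- by constructor 3.
- by constructor 1; exists (2 ^ a); rewrite ?expnS //; constructor 2; exists a.
wlog le_ab : a b / a <= b.
  by move=> H e; case: (leqP a b) => [|/ltnW] le; [|rewrite addnC in e]; apply: (H _ _ le e).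
case: a b le_ab => [|a] [|b] // _ ->.
- by constructor 1; exists 1 => //; constructor 2; exists 0.
- case: b => [|b]; first by constructor 2.
  by constructor 3; rewrite -modnDmr pow4.
- constructor 1; exists (2 ^ a + 2 ^ b); last by rewrite !expnS mulnDr.
  by constructor 3; exists a, b.
Qed.

(** The factor 9 in 18 excludes t = 3, the factor 2 excludes t = 1 mod 4. *)
Lemma not_representable_double (n : nat) :
  18 %| n -> ~ representable n -> ~ representable (2 * n).
Proof.
move=> /dvdnP[k n_eq] nrep_n [s [t [s_sq /pow2_sum_cases t_cases e]]].
case: t_cases => [[t' t'_pow t_eq]|t3|t4].
- apply: nrep_n; exists (n - t'), t'; split=> //; last by lia.
  by apply: two_squares_half; have <- : s = 2 * (n - t') by lia.
- have [j s_eq] : exists j, s = 3 * (3 * j + 2) by exists (4 * k - 1); lia.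
  apply: (not_two_squares_mul 3 (3 * j + 2)) => //; last by rewrite -s_eq.
  by rewrite mulnC /coprime gcdnMDl.
- apply: (not_two_squares_mul s 1); rewrite ?coprimen1 ?muln1 //; lia.
Qed.

(** * A non-representable multiple of 18 *)

(** The criterion [not_two_squares_mul] for the factorization s = w * r, with w
    or r in the role of q; the second choice treats numbers such as
    s = 2 * (4 j + 3) with w = 2.  For s = 0 the test
    fails: r = 0 is coprime only to w = 1, and neither is 3 mod 4. *)
Definition certifies (s w : N) : bool :=
  let r := N.div s w in
  [&& N.eqb (w * r) s, N.eqb (N.gcd w r) 1
    & N.eqb w (4 * N.div w 4 + 3) || N.eqb r (4 * N.div r 4 + 3)].

Lemma Ngcd_coprime (w r : N) : N.gcd w r = 1%num -> coprime w r.
Proof.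
move=> g1; rewrite /coprime -dvdn1.
have [] := N.gcd_bezout w r; rewrite g1 => -[a [b e]].
  have {}e : a * w = b * r + 1 by lia.
  by rewrite -(dvdn_addr 1 (dvdn_mull b (dvdn_gcdr w r))) -e dvdn_mull ?dvdn_gcdl.
have {}e : a * r = b * w + 1 by lia.
by rewrite -(dvdn_addr 1 (dvdn_mull b (dvdn_gcdl w r))) -e dvdn_mull ?dvdn_gcdr.
Qed.

Lemma certifies_not_two_squares (s w : N) :
  certifies s w -> ~ two_squares s.
Proof.
rewrite /certifies; move: (N.div s w) => r /and3P[/N.eqb_eq <- /N.eqb_eq /Ngcd_coprime cop].
have -> : nat_of_bin (w * r) = nat_of_bin w * nat_of_bin r by lia.
case/orP=> /N.eqb_eq e.
- by apply: not_two_squares_mul cop; lia.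
- by rewrite mulnC; apply: not_two_squares_mul; [lia | rewrite coprime_sym].
Qed.

Definition seed : N := 1151121374334%num.

(** Found by a greedy search over powers of 2 and odd powers of primes that are
    3 mod 4.  The modulus 2 settles most cases; 27 and 2187 = 3 ^ 7 serve the
    numbers whose exact power of 3 is larger than 3, and the six moduli above
    20000 the six numbers in which neither the odd part is 3 mod 4 nor any
    prime 3 mod 4 below 20000 has odd exponent. *)
Definition moduli : seq N :=
  [:: 2; 3; 4; 7; 11; 19; 23; 27; 31; 43; 47; 59; 67; 71; 79; 103; 163; 359;
      431; 727; 1423; 1699; 2187; 5623; 10651; 13751; 16363; 29527; 30839;
      32587; 98011; 136943; 213307]%num.

Definition pow2N (a : nat) : N := iter a N.double 1%num.

Lemma pow2NE (a : nat) : nat_of_bin (pow2N a) = 2 ^ a.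
Proof. by elim: a => // a IHa; rewrite expnS -IHa /=; lia. Qed.

Definition small_pow2_sums (k : nat) : seq N :=
  let ps := map pow2N (iota 0 k) in
  0%num :: ps ++ [seq (p + q)%num | p <- ps, q <- ps].

Lemma pow2_sum_small (k t : nat) : pow2_sum t -> t < 2 ^ k ->
  exists2 T, T \in small_pow2_sums k & nat_of_bin T = t.
Proof.
have small a : 2 ^ a < 2 ^ k -> pow2N a \in map pow2N (iota 0 k).
  by rewrite ltn_exp2l // => lt_ak; apply: map_f; rewrite mem_iota.
case=> [->|[a ->]|[a [b ->]]] lt_t.
- by exists 0%num; rewrite ?inE.
- exists (pow2N a); rewrite ?pow2NE //.
  by rewrite inE mem_cat small ?orbT.
- exists (pow2N a + pow2N b)%num; last by rewrite -!pow2NE; lia.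
  rewrite inE mem_cat allpairs_f ?orbT //; apply: small; lia.
Qed.

(** The bound 41 suffices because the seed is below 2 ^ 41; the sums that
    exceed the seed are skipped, as subtraction on N is truncated. *)
Lemma seed_checked :
  all (fun T => N.ltb seed T || has (certifies (seed - T)) moduli)
      (small_pow2_sums 41).
Proof. by vm_compute. Qed.

Lemma seed_bounds : 0 < nat_of_bin seed < 2 ^ 41 /\ 18 %| seed.
Proof. 
split.
  rewrite -pow2NE; have : N.ltb 0 seed && N.ltb seed (pow2N 41) by vm_compute.
  by move: seed (pow2N 41) => S P; lia.
have : N.eqb seed (N.div seed 18 * 18) by vm_compute.
move: seed (N.div seed 18) => S Q /N.eqb_eq e; apply/dvdnP; exists Q; lia.
Qed.

Lemma not_representable_seed : ~ representable seed.
Proof.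
move=> [s [t [s_sq t_pow e]]].
have [/andP[_ lt_seed] _] := seed_bounds.
have [|T T_in T_eq] := pow2_sum_small 41 t t_pow; first by lia.
have := allP seed_checked T T_in.
case/orP; first by move: seed e {lt_seed} => S e; lia.
case/hasP=> w _ /certifies_not_two_squares; apply.
by have -> : nat_of_bin (seed - T) = s by move: seed e {lt_seed} => S e; lia.
Qed.

(** The value of the seed is hidden from here on, so that no later unification
    unfolds it as a unary number. *)
Lemma exists_seed : exists m, [/\ 0 < m, 18 %| m & ~ representable m].
Proof.
have [/andP[seed_gt0 _] dvd18] := seed_bounds.
exact: ex_intro _ _ (And3 seed_gt0 dvd18 not_representable_seed).
Qed.

(** * Infinitude *)

Lemma not_representable_pow2_mul (m k : nat) :
  18 %| m -> ~ representable m -> ~ representable (2 ^ k * m).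
Proof.
move=> dvd18 nrep_m; elim: k => [|k IHk]; first by rewrite mul1n.
by rewrite expnS -mulnA; apply: not_representable_double; rewrite ?dvdn_mull.
Qed.

Lemma representable_of_int (n : nat) :
  two_squares_and_at_most_two_powers_of_2 n%:Z -> representable n.
Proof.
have sqE (x y : int) : (x ^+ 2 + y ^+ 2 = (`|x| ^ 2 + `|y| ^ 2)%N%:Z)%R by lia.
have powE a : (2 ^+ a = (2 ^ a)%N%:Z :> int)%R by elim: a => // a IHa; rewrite exprS expnS PoszM IHa.
case=> [[x [y]]|[x [y [a]]]|[x [y [a [b]]]]]; rewrite sqE ?powE => e;
  [exists (`|x| ^ 2 + `|y| ^ 2), 0 | exists (`|x| ^ 2 + `|y| ^ 2), (2 ^ a)
  |exists (`|x| ^ 2 + `|y| ^ 2), (2 ^ a + 2 ^ b)];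
  split; try (by exists `|x|, `|y|); try lia.
- by constructor 1.
- by constructor 2; exists a.
- by constructor 3; exists a, b.
Qed.

Local Open Scope ring_scope.

Theorem theorem3 :
  infinite_set
    [set n : int | 0 < n /\ ~ two_squares_and_at_most_two_powers_of_2 n].
Proof.
have [m [m_gt0 dvd18 nrep_m]] := exists_seed.
pose f (k : nat) := (2 ^ k * m)%N%:Z.
have f_inj : injective f.
  by move=> j k [] /eqP; rewrite eqn_pmul2r // eqn_exp2l // => /eqP.
move=> /(finite_preimage (in2W f_inj)) fin; apply: infinite_nat.
apply: sub_finite_set fin => k _ /=; split.
  by rewrite ltz_nat muln_gt0 expn_gt0.
by move=> /representable_of_int; apply: not_representable_pow2_mul.
Qed.
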